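(* Let $\mathcal{C}$ be a category with an $(\mathcal{E},\mathcal{M})$-factorization system, $I$ an object, and $F\colon\mathcal{C}\to\mathcal{C}$ a functor that preserves $\mathcal{M}$ and admits precise factorizations w.r.t. $\mathcal{M}$. Let $(C,c,i_C)$ be a pointed $F$-coalgebra and construct $m_k\colon C_k\to C$ in $\mathcal{M}$ and $F$-precise $c_k\colon C_k\to FC_{k+1}$ ($k\in\mathbb{N}$) by: $i_C=m_0\cdot i_C'$ is an $(\mathcal{E},\mathcal{M})$-factorization ($i_C'\colon I\to C_0$ in $\mathcal{E}$, $m_0\in\mathcal{M}$), and for each $k$, $c\cdot m_k=Fm_{k+1}\cdot c_k$ is a precise factorization (with $m_{k+1}\in\mathcal{M}$, $c_k$ $F$-precise). Assume $\coprod_{k\in\mathbb{N}}C_k$ exists and equip it with the pointed coalgebra structure $\gamma=[F\mathsf{in}_{k+1}]_k\cdot\coprod_kc_k$ and point $\mathsf{in}_0\cdot i_C'$, so that $[m_k]_k$ is a pointed coalgebra morphism to $(C,c,i_C)$. Let $[m_k]_{k}=m'\cdot e$ be an $(\mathcal{E},\mathcal{M})$-factorization in $\mathcal{C}$ with $e\colon\coprod_kC_k\to R$ in $\mathcal{E}$ and $m'\colon R\to C$ in $\mathcal{M}$, let $r\colon R\to FR$ be the unique diagonal fill-in with $r\cdot e=Fe\cdot\gamma$ and $Fm'\cdot r=c\cdot m'$, and let $i_R=e\cdot\mathsf{in}_0\cdot i_C'$. Then the pointed coalgebra $(R,r,i_R)$ is $\mathcal{M}$-reachable (and $m'\colon(R,r,i_R)\to(C,c,i_C)$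 is an $\mathcal{M}$-subcoalgebra).
   Context: An $(\mathcal{E},\mathcal{M})$-factorization system: classes $\mathcal{E},\mathcal{M}$ closed under composition, containing all isomorphisms, every morphism factors as $m\cdot e$ ($e\in\mathcal{E}$, $m\in\mathcal{M}$), with unique diagonal fill-ins for commutative squares $g\cdot e=m\cdot f$; $\mathcal{M}$ need not consist of monomorphisms. $F$ preserves $\mathcal{M}$ if $Fm\in\mathcal{M}$ for $m\in\mathcal{M}$. A morphism $p\colon P\to FR$ is $F$-precise (w.r.t. $\mathcal{M}$) if for all $f\colon P\to FC'$ and $m\colon R\to D$, $h\colon C'\to D$ in $\mathcal{M}$ with $Fm\cdot p=Fh\cdot f$ there is $d\colon R\to C'$ with $Fd\cdot p=f$ and $h\cdot d=m$. $F$ admits precise factorizations if every $f\colon S\to FY$ equals $Fh\cdot p$ for some $h\in\mathcal{M}$ and $F$-precise $p$. A pointed $F$-coalgebra is $(C,c,i_C)$ with $c\colon C\to FC$, $i_C\colon I\to C$; pointed coalgebra morphisms $h$ satisfy $d\cdot h=Fh\cdot c$ and preserve points. A split epimorphism of pointed coalgebras is a pointed coalgebra morphism $h$ with a pointed coalgebra morphism $s$, $h\cdot s=\mathrm{id}$. A pointed coalgebra is $\mathcal{M}$-reachable if every pointed coalgebra morphism into it whose underlying morphism is in $\mathcal{M}$ is a split epimorphism of pointed coalgebras. *)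

(* Defs.v *)
From Corelib Require Import ssreflect ssrbool.

Set Implicit Arguments.
Unset Strict Implicit.
Unset Printing Implicit Defensive.

Declare Scope cat_scope.
Delimit Scope cat_scope with cat.
Local Open Scope cat_scope.

Reserved Notation "A ~> B" (at level 90, right associativity).
Reserved Notation "g ∘ f" (at level 40, left associativity).

Record Category := {
  Ob :> Type;
  Hom : Ob -> Ob -> Type;
  idm : forall A, Hom A A;
  comp : forall A B D, Hom B D -> Hom A B -> Hom A D;
  comp_idl : forall A B (f : Hom A B), comp (idm B) f = f;
  comp_idr : forall A B (f : Hom A B), comp f (idm A) = f;
  comp_assoc : forall A B D K (h : Hom D K) (g : Hom B D) (f : Hom A B),
    comp h (comp g f) = comp (comp h g) f }.

Arguments Hom {c}.
Arguments idm {c} A.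
Arguments comp {c A B D}.

Notation "A ~> B" := (Hom A B) : cat_scope.
Notation "g ∘ f" := (comp g f) : cat_scope.

Record Functor (C D : Category) := {
  fobj :> C -> D;
  fmap : forall A B : C, (A ~> B) -> (fobj A ~> fobj B);
  fmap_id : forall A : C, fmap (idm A) = idm (fobj A);
  fmap_comp : forall (A B K : C) (g : B ~> K) (f : A ~> B),
    fmap (g ∘ f) = fmap g ∘ fmap f }.

Arguments fmap {C D} f {A B} f0 : rename.

Definition is_iso (C : Category) (A B : C) (f : A ~> B) : Prop :=
  exists g : B ~> A, g ∘ f = idm A /\ f ∘ g = idm B.

Definition MorClass (C : Category) := forall A B : C, (A ~> B) -> Prop.

Definition closed_under_comp (C : Category) (K : MorClass C) : Prop :=
  forall (X Y Z : C) (g : Y ~> Z) (f : X ~> Y), K _ _ g -> K _ _ f -> K _ _ (g ∘ f).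

Definition contains_isos (C : Category) (K : MorClass C) : Prop :=
  forall (X Y : C) (f : X ~> Y), is_iso f -> K _ _ f.

Definition em_factorization (C : Category) (E M : MorClass C)
    (X Y Z : C) (f : X ~> Z) (e : X ~> Y) (m : Y ~> Z) : Prop :=
  [/\ E _ _ e, M _ _ m & f = m ∘ e].

Definition diagonal (C : Category) (X Y Z W : C)
    (e : X ~> Y) (m : Z ~> W) (f : X ~> Z) (g : Y ~> W) (d : Y ~> Z) : Prop :=
  d ∘ e = f /\ m ∘ d = g.

Record FactorizationSystem (C : Category) (E M : MorClass C) : Prop := {
  fs_E_comp : closed_under_comp E;
  fs_M_comp : closed_under_comp M;
  fs_E_iso : contains_isos E;
  fs_M_iso : contains_isos M;
  fs_factor : forall (X Z : C) (f : X ~> Z),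
    exists (Y : C) (e : X ~> Y) (m : Y ~> Z), em_factorization E M f e m;
  fs_diagonal : forall (X Y Z W : C)
      (e : X ~> Y) (m : Z ~> W) (f : X ~> Z) (g : Y ~> W),
    E _ _ e -> M _ _ m -> g ∘ e = m ∘ f -> exists! d : Y ~> Z, diagonal e m f g d }.

Definition preserves (C : Category) (F : Functor C C) (M : MorClass C) : Prop :=
  forall (X Y : C) (m : X ~> Y), M _ _ m -> M _ _ (fmap F m).

Definition precise (C : Category) (F : Functor C C) (M : MorClass C)
    (P R : C) (p : P ~> F R) : Prop :=
  forall (C' D : C) (f : P ~> F C') (m : R ~> D) (h : C' ~> D),
    M _ _ m -> M _ _ h -> fmap F m ∘ p = fmap F h ∘ f ->
    exists d : R ~> C', fmap F d ∘ p = f /\ h ∘ d = m.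

Definition precise_factorization (C : Category) (F : Functor C C) (M : MorClass C)
    (S R Y : C) (f : S ~> F Y) (p : S ~> F R) (h : R ~> Y) : Prop :=
  [/\ M _ _ h, precise M p & f = fmap F h ∘ p].

Definition admits_precise_factorizations
    (C : Category) (F : Functor C C) (M : MorClass C) : Prop :=
  forall (S Y : C) (f : S ~> F Y),
    exists (R : C) (p : S ~> F R) (h : R ~> Y), precise_factorization M f p h.

Record PointedCoalgebra (C : Category) (F : Functor C C) (I : C) := MkPointedCoalgebra {
  carrier :> C;
  str : carrier ~> F carrier;
  point : I ~> carrier }.

Definition is_pcoalg_mor (C : Category) (F : Functor C C) (I : C)
    (X Y : PointedCoalgebra F I) (h : X ~> Y) : Prop :=
  str Y ∘ h = fmap F h ∘ str X /\ h ∘ point X = point Y.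

Definition is_pcoalg_split_epi (C : Category) (F : Functor C C) (I : C)
    (X Y : PointedCoalgebra F I) (h : X ~> Y) : Prop :=
  is_pcoalg_mor h /\ exists s : Y ~> X, is_pcoalg_mor s /\ h ∘ s = idm (carrier Y).

Definition is_subcoalgebra (C : Category) (M : MorClass C) (F : Functor C C) (I : C)
    (X Y : PointedCoalgebra F I) (h : X ~> Y) : Prop :=
  is_pcoalg_mor h /\ M _ _ h.

Definition reachable (C : Category) (M : MorClass C) (F : Functor C C) (I : C)
    (Y : PointedCoalgebra F I) : Prop :=
  forall (X : PointedCoalgebra F I) (h : X ~> Y),
    is_pcoalg_mor h -> M _ _ h -> is_pcoalg_split_epi h.

Record Coproduct (C : Category) (J : Type) (X : J -> C) := {
  coprod :> C;
  inj : forall j, X j ~> coprod;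
  copair : forall Y : C, (forall j, X j ~> Y) -> (coprod ~> Y);
  copair_inj : forall (Y : C) (f : forall j, X j ~> Y) j, copair f ∘ inj j = f j;
  copair_unique : forall (Y : C) (f : forall j, X j ~> Y) (g : coprod ~> Y),
    (forall j, g ∘ inj j = f j) -> g = copair f }.

Arguments inj {C J X} c j.
Arguments copair {C J X} c {Y} f.

Definition coprod_map (C : Category) (J : Type) (X Y : J -> C)
    (cX : Coproduct X) (cY : Coproduct Y) (f : forall j, X j ~> Y j) : cX ~> cY :=
  copair cX (fun j => inj cY j ∘ f j).

(** The structure [F in_(k+1)]_k · ∐_k c_k on ∐_k C_k.  It is written in the
    fused form [F in_(k+1) · c_k]_k, because only ∐_k C_k, and not the
    intermediate object ∐_k F C_(k+1), is assumed to exist; see [chain_strE]. *)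
Definition chain_str (C : Category) (F : Functor C C) (Ck : nat -> C)
    (c : forall k, Ck k ~> F (Ck (S k))) (cp : Coproduct Ck) : cp ~> F cp :=
  copair cp (fun k => fmap F (inj cp (S k)) ∘ c k).

Lemma chain_strE (C : Category) (F : Functor C C) (Ck : nat -> C)
    (c : forall k, Ck k ~> F (Ck (S k))) (cp : Coproduct Ck)
    (cpF : Coproduct (fun k => F (Ck (S k)))) :
  chain_str c cp =
  copair cpF (fun k => fmap F (inj cp (S k))) ∘ coprod_map cp cpF c.
Proof.
symmetry; apply: copair_unique => k.
rewrite -comp_assoc /coprod_map copair_inj comp_assoc.
by congr (_ ∘ _); apply: (copair_inj cpF).
Qed.

Definition chain_coalgebra (C : Category) (F : Functor C C) (I : C) (Ck : nat -> C)
    (i' : I ~> Ck 0) (c : forall k, Ck k ~> F (Ck (S k))) (cp : Coproduct Ck) :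
    PointedCoalgebra F I :=
  MkPointedCoalgebra (chain_str c cp) (inj cp 0 ∘ i').

(* Main.v *)
(** Let [h : S -> R] be an M-subcoalgebra.  Since M is left cancellable and
    [m' ∘ e ∘ in_k = m_k], each [e ∘ in_k] lies in M.  Hence the diagonal fill-in
    (for [k = 0]) and precision of the [c_k] (for the successor steps) can be used
    over [R] instead of over [C], and give [d_k : C_k -> S] with
    [h ∘ d_k = e ∘ in_k]; lifting over [R] matters because [m'] need not be monic.
    The [d_k] assemble to a pointed coalgebra morphism [d] from the coproduct to
    [S] with [h ∘ d = e], and the diagonal of [id ∘ e = h ∘ d] splits [h]. *)
From Corelib Require Import ssreflect.
From Stdlib Require Import ClassicalEpsilon.
Require Import Defs.

Set Implicit Arguments.
Unset Strict Implicit.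

Local Open Scope cat_scope.

Lemma copair_ext (C : Category) (J : Type) (A : J -> C) (cp : Coproduct A)
    (Y : C) (f g : cp ~> Y) :
  (forall j, f ∘ inj cp j = g ∘ inj cp j) -> f = g.
Proof.
move=> fg; rewrite (copair_unique (f := fun j => g ∘ inj cp j) fg).
by symmetry; apply: copair_unique.
Qed.

(** Both [f] and [g] are diagonals of the square with sides [g ∘ e] and [m ∘ g]. This joint
    cancellation stands in for E being epic and M monic, which are not assumed. *)
Lemma em_cancel (C : Category) (E M : MorClass C) (fs : FactorizationSystem E M)
    (X Y Z W : C) (e : X ~> Y) (m : Z ~> W) (f g : Y ~> Z) :
  E _ _ e -> M _ _ m -> f ∘ e = g ∘ e -> m ∘ f = m ∘ g -> f = g.
Proof.
move=> Ee Mm fge mfg.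
have sq : (m ∘ g) ∘ e = m ∘ (g ∘ e) by rewrite comp_assoc.
have [d [_ ud]] := fs_diagonal fs Ee Mm sq.
by rewrite -(ud f (conj fge mfg)); apply: ud; split.
Qed.

Lemma M_left_cancel (C : Category) (E M : MorClass C) (fs : FactorizationSystem E M)
    (X Y Z : C) (g : Y ~> Z) (f : X ~> Y) :
  M _ _ g -> M _ _ (g ∘ f) -> M _ _ f.
Proof.
move=> Mg Mgf; have [W [q [n [Eq Mn fE]]]] := fs_factor fs f.
have Mgn : M _ _ (g ∘ n) by apply: (fs_M_comp fs).
have sq : (g ∘ n) ∘ q = (g ∘ f) ∘ idm X by rewrite comp_idr fE comp_assoc.
have [t [[tq gft] _]] := fs_diagonal fs Eq Mgf sq.
(* It remains to see that the E-part [q] of [f] is invertible: [t] is a left inverse, and [q ∘ t]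
   agrees with the identity after [q] and before [g ∘ n]. *)
rewrite fE; apply: (fs_M_comp fs) => //; apply: (fs_M_iso fs).
exists t; split=> //; apply: (em_cancel fs Eq Mgn).
- by rewrite -comp_assoc tq comp_idl comp_idr.
- by rewrite comp_idr -[RHS]gft fE !comp_assoc.
Qed.

(** Precision yields each next lift only as a mere existence depending on the previous one. The
    invariant [P] is carried in a subset type so that every step can be continued. *)
Lemma dependent_choice_seq (A : nat -> Type) (P : forall k, A k -> Prop)
    (Q : forall k, A k -> A (S k) -> Prop) (a0 : A 0) :
  P 0 a0 -> (forall k a, P k a -> exists b, P (S k) b /\ Q k a b) ->
  exists a : forall k, A k, a 0 = a0 /\ forall k, P k (a k) /\ Q k (a k) (a (S k)).
Proof.
move=> P0 step.
have next k (x : {a | P k a}) :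
    {y : {b | P (S k) b} | Q k (proj1_sig x) (proj1_sig y)}.
  have [b [Pb Qb]] :=
    constructive_indefinite_description _ (step k _ (proj2_sig x)).
  by exists (exist _ b Pb).
pose s := nat_rect (fun k => {a | P k a}) (exist _ a0 P0)
  (fun k x => proj1_sig (next k x)).
exists (fun k => proj1_sig (s k)); split=> // k; split; first exact: proj2_sig.
exact: (proj2_sig (next k (s k))).
Qed.

Lemma E_quotient_reachable (C : Category) (E M : MorClass C)
    (fs : FactorizationSystem E M) (I : C) (F : Functor C C) (F_M : preserves F M)
    (G R : PointedCoalgebra F I) (e : G ~> R) :
  E _ _ e -> is_pcoalg_mor e ->
  (forall (S : PointedCoalgebra F I) (h : S ~> R), is_pcoalg_mor h -> M _ _ h ->
     exists d : G ~> S, is_pcoalg_mor d /\ h ∘ d = e) ->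
  reachable M R.
Proof.
move=> Ee [re pe] lift S h hmor Mh; split=> //.
have [d [[sd pd] hd]] := lift S h hmor Mh.
have [sh ph] := hmor.
have sq : idm R ∘ e = h ∘ d by rewrite comp_idl hd.
have [t [[te ht] _]] := fs_diagonal fs Ee Mh sq.
exists t; split=> //; split.
(* Preservation of M enters here: [str S ∘ t] and [fmap F t ∘ str R] are compared after [e] in E and
   before [fmap F h] in M. *)
- apply: (em_cancel fs Ee (F_M _ _ _ Mh)).
  + by rewrite -!comp_assoc te re comp_assoc -fmap_comp te.
  + rewrite !comp_assoc -sh -fmap_comp ht fmap_id comp_idl.
    by rewrite -comp_assoc ht comp_idr.
- by rewrite -pe comp_assoc te.
Qed.

Lemma chain_lift (C : Category) (E M : MorClass C) (fs : FactorizationSystem E M)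
    (I : C) (F : Functor C C) (Ck : nat -> C) (i' : I ~> Ck 0)
    (c : forall k, Ck k ~> F (Ck (S k))) (cp : Coproduct Ck)
    (R S : PointedCoalgebra F I) (e : cp ~> R) (h : S ~> R) :
  E _ _ i' -> (forall k, precise M (c k)) ->
  is_pcoalg_mor (X := chain_coalgebra i' c cp) e ->
  (forall k, M _ _ (e ∘ inj cp k)) ->
  is_pcoalg_mor h -> M _ _ h ->
  exists d : cp ~> S,
    is_pcoalg_mor (X := chain_coalgebra i' c cp) d /\ h ∘ d = e.
Proof.
move=> Ei prc [/= re pe] Me [sh ph] Mh.
have sq : (e ∘ inj cp 0) ∘ i' = h ∘ point S by rewrite ph -pe comp_assoc.
have [d0 [[d0i hd0] _]] := fs_diagonal fs Ei Mh sq.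
(* The invariant makes the next precision square commute; the relation between neighbours is the
   coalgebra law of [copair cp d] on the [k]-th summand. *)
have [||d [dE dP]] := @dependent_choice_seq (fun k => Ck k ~> S)
  (fun k a => h ∘ a = e ∘ inj cp k)
  (fun k a b => fmap F b ∘ c k = str S ∘ a) d0.
- exact: hd0.
- move=> k a ha.
  (* Both sides equal [str R ∘ e ∘ inj cp k]. *)
  have eq : fmap F (e ∘ inj cp (Datatypes.S k)) ∘ c k = fmap F h ∘ (str S ∘ a).
    rewrite comp_assoc -sh -comp_assoc ha comp_assoc re -comp_assoc.
    by rewrite /chain_str copair_inj fmap_comp !comp_assoc.
  have [b [bc hb]] := prc k _ _ _ _ _ (Me _) Mh eq.
  by exists b.
- exists (copair cp d); split; first split=> /=.
  + apply: copair_ext => k; rewrite -!comp_assoc /chain_str !copair_inj.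
    by rewrite comp_assoc -fmap_comp copair_inj (proj2 (dP k)).
  + by rewrite comp_assoc copair_inj dE.
  + apply: copair_ext => k; rewrite -comp_assoc copair_inj.
    exact: (proj1 (dP k)).
Qed.

Theorem theorem4p12
  (C : Category) (E M : MorClass C) (fs : FactorizationSystem E M)
  (I : C) (F : Functor C C)
  (F_M : preserves F M) (F_precise : admits_precise_factorizations F M)
  (X : PointedCoalgebra F I)
  (Ck : nat -> C) (i' : I ~> Ck 0)
  (m : forall k, Ck k ~> X) (c : forall k, Ck k ~> F (Ck (S k)))
  (fact_i : em_factorization E M (point X) i' (m 0))
  (fact_c : forall k, precise_factorization M (str X ∘ m k) (c k) (m (S k)))
  (cp : Coproduct Ck)
  (R : C) (e : cp ~> R) (m' : R ~> X)
  (fact_m : em_factorization E M (copair cp m) e m') :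
  let G : PointedCoalgebra F I := chain_coalgebra i' c cp in
  let fill_in (r : R ~> F R) : Prop :=
    diagonal e (fmap F m') (fmap F e ∘ str G) (str X ∘ m') r in
  is_pcoalg_mor (X := G) (Y := X) (copair cp m)
  /\ (exists! r : R ~> F R, fill_in r)
  /\ (forall r : R ~> F R, fill_in r ->
        let RC : PointedCoalgebra F I :=
          MkPointedCoalgebra r (e ∘ inj cp 0 ∘ i') in
        reachable M RC /\ is_subcoalgebra M (X := RC) (Y := X) m').
Proof.
move=> G fill_in; have [Ei Mm0 iE] := fact_i; have [Ee Mm' mE] := fact_m.
have copair_mor : is_pcoalg_mor (X := G) (Y := X) (copair cp m).
{ split=> /=.
  - apply: copair_ext => k; have [_ _ cE] := fact_c k.
    rewrite -!comp_assoc /chain_str !copair_inj comp_assoc -fmap_comp copair_inj.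
    exact: cE.
  - by rewrite comp_assoc copair_inj iE. }
have [strE pointE] := copair_mor.
split=> //; split.
  (* The square for the fill-in is the coalgebra law of [copair cp m] with [m' ∘ e] substituted on
     both sides. *)
  apply: (fs_diagonal fs Ee (F_M _ _ _ Mm')).
  by rewrite -comp_assoc -mE strE {1}mE fmap_comp comp_assoc.
move=> r [re m'r] RC.
have Mm k : M _ _ (m k) by case: k => [|k] //; have [] := fact_c k.
have emor : is_pcoalg_mor (X := G) (Y := RC) e by split; rewrite //= comp_assoc.
have Me k : M _ _ (e ∘ inj cp k).
  by apply: (M_left_cancel fs (g := m')); rewrite // comp_assoc -mE copair_inj.
split.
- apply: (E_quotient_reachable (G := G) (R := RC) fs F_M Ee emor) => S h hmor Mh.
  apply: (chain_lift (R := RC) fs) => // k.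
  by have [] := fact_c k.
- split=> //; split=> //=.
  by rewrite !comp_assoc -mE -comp_assoc.
Qed.
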